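(* Let $C_1(n)$ denote the number of partitions of $n$ into parts congruent to $\pm1,\pm6,\pm13$ or $14\pmod{28}$ such that parts congruent to $\pm6\pmod{28}$ come in 2 colours and parts congruent to $14\pmod{28}$ come in 4 colours. Let $C_2(n)$ denote the number of partitions of $n$ into parts congruent to $\pm1,\pm8,\pm13$ or $14\pmod{28}$ such that parts congruent to $\pm8\pmod{28}$ come in 2 colours and parts congruent to $14\pmod{28}$ come in 4 colours. Let $C_3(n)$ denote the number of partitions of $n$ into parts congruent to $\pm6,\pm7$ or $\pm8\pmod{28}$, each part coming in 2 colours. Then for every integer $n\ge1$, $$C_1(n)-C_2(n-1)-C_3(n)=0.$$ Equivalently, as formal power series, $$\frac{1}{(q^6,q^{22};q^{28})_\infty^2(q^{14};q^{28})_\infty^4(q,q^{27},q^{13},q^{15};q^{28})_\infty}-\frac{q}{(q^8,q^{20};q^{28})_\infty^2(q^{14};q^{28})_\infty^4(q,q^{27},q^{13},q^{15};q^{28})_\infty}=\frac{1}{(q^6,q^{22},q^7,q^{21},q^8,q^{20};q^{28})_\infty^2}.$$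
   Context: $(\lambda;q)_\infty=\prod_{t\ge0}(1-\lambda q^t)$ and $(a_1,\dots,a_m;q)_\infty=\prod_j(a_j;q)_\infty$. A partition in which parts of a given residue class ''come in $r$ colours'' means each such part size has $r$ distinguishable copies; thus $1/(q^s;q^m)_\infty^r$ generates partitions into parts $\equiv s\pmod m$ with $r$ colours. Conventions: $C_i(0)=1$; ''parts congruent to $\pm a \pmod{28}$'' means parts congruent to $a$ or $28-a$ modulo 28. *)

(* Defs.v *)
From HB Require Import structures.
From mathcomp Require Import all_boot all_order all_algebra.
From mathcomp Require Import boolp.

Set Implicit Arguments.
Unset Strict Implicit.
Unset Printing Implicit Defensive.

Import GRing.Theory.

(* [colours s] is the number of colours available for the part size [s]
   (0 when [s] is not an allowed part).  An element of [coloured_part colours n]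
   is a part [(tag p).+1] between 1 and [n] together with one of its colours. *)
Definition coloured_part (colours : nat -> nat) (n : nat) : finType :=
  {i : 'I_n & 'I_(colours i.+1)}.

(* A coloured partition of [n] is given by the multiplicity of each coloured
   part; parts and multiplicities of a partition of [n] never exceed [n]. *)
Definition coloured_partitions (colours : nat -> nat) (n : nat) :
    {set {ffun coloured_part colours n -> 'I_n.+1}} :=
  [set m : {ffun coloured_part colours n -> 'I_n.+1}
     | \sum_(p : coloured_part colours n) (tag p).+1 * m p == n].

Definition pm28 (a s : nat) : bool :=
  (s == a %[mod 28]) || (s == 28 - a %[mod 28]).

Definition colours1 (s : nat) : nat :=
  if pm28 1 s || pm28 13 s then 1
  else if pm28 6 s then 2
  else if s == 14 %[mod 28] then 4
  else 0.

Definition colours2 (s : nat) : nat :=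
  if pm28 1 s || pm28 13 s then 1
  else if pm28 8 s then 2
  else if s == 14 %[mod 28] then 4
  else 0.

Definition colours3 (s : nat) : nat :=
  if pm28 6 s || pm28 7 s || pm28 8 s then 2 else 0.

Definition C1 (n : nat) : nat := #|coloured_partitions colours1 n|.
Definition C2 (n : nat) : nat := #|coloured_partitions colours2 n|.
Definition C3 (n : nat) : nat := #|coloured_partitions colours3 n|.

Lemma card_coloured_partitions0 (colours : nat -> nat) :
  #|coloured_partitions colours 0| = 1.
Proof.
have noP (p : coloured_part colours 0) : False by case: p => - [].
rewrite (_ : coloured_partitions _ _ = setT); last first.
  apply/setP=> m; rewrite !inE; apply/eqP; apply: big1 => p _.
  by case: (noP p).
by rewrite cardsT card_ffun card_ord exp1n.
Qed.

Local Open Scope ring_scope.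

Record fps (R : Type) := FPS { coefs : nat -> R }.

Lemma fpsP (R : Type) (f g : fps R) : coefs f =1 coefs g -> f = g.
Proof. by case: f g => [f] [g] /= /funext ->. Qed.

HB.instance Definition _ (R : Type) := gen_eqMixin (fps R).
HB.instance Definition _ (R : Type) := gen_choiceMixin (fps R).

Definition fps_zero (R : zmodType) : fps R := FPS (fun=> 0).
Definition fps_opp (R : zmodType) (f : fps R) : fps R :=
  FPS (fun n => - coefs f n).
Definition fps_add (R : zmodType) (f g : fps R) : fps R :=
  FPS (fun n => coefs f n + coefs g n).

Lemma fps_addA (R : zmodType) : associative (@fps_add R).
Proof. by move=> f g h; apply: fpsP => n /=; rewrite addrA. Qed.
Lemma fps_addC (R : zmodType) : commutative (@fps_add R).
Proof. by move=> f g; apply: fpsP => n /=; rewrite addrC. Qed.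
Lemma fps_add0 (R : zmodType) : left_id (@fps_zero R) (@fps_add R).
Proof. by move=> f; apply: fpsP => n /=; rewrite add0r. Qed.
Lemma fps_addN (R : zmodType) :
  left_inverse (@fps_zero R) (@fps_opp R) (@fps_add R).
Proof. by move=> f; apply: fpsP => n /=; rewrite addNr. Qed.

HB.instance Definition _ (R : zmodType) := GRing.isZmodule.Build (fps R)
  (@fps_addA R) (@fps_addC R) (@fps_add0 R) (@fps_addN R).

Definition fps_one (R : comUnitRingType) : fps R := FPS (fun n => (n == 0)%:R).
Definition fps_mul (R : comUnitRingType) (f g : fps R) : fps R :=
  FPS (fun n => \sum_(i < n.+1) coefs f i * coefs g (n - i)).

Definition fps_trunc (R : comUnitRingType) (N : nat) (f : fps R) : {poly R} :=
  \poly_(i < N) coefs f i.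

Lemma coef_trunc_mul (R : comUnitRingType) (N k : nat) (f g : fps R) :
  (k < N)%N ->
  (fps_trunc N f * fps_trunc N g)`_k = coefs (fps_mul f g) k.
Proof.
move=> kN; rewrite coefM /=; apply: eq_bigr => i _.
rewrite !coef_poly (leq_ltn_trans (leq_subr _ _) kN).
by rewrite (leq_ltn_trans (leq_ord i) kN).
Qed.

Lemma fps_mulC (R : comUnitRingType) : commutative (@fps_mul R).
Proof.
by move=> f g; apply: fpsP => n; rewrite -!(@coef_trunc_mul _ n.+1) // mulrC.
Qed.

Lemma fps_mulA (R : comUnitRingType) : associative (@fps_mul R).
Proof.
move=> f g h; apply: fpsP => n.
pose t := @fps_trunc R n.+1.
transitivity ((t f * (t g * t h))`_n).
  rewrite coefM; apply: eq_bigr => i _.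
  by rewrite coef_trunc_mul ?ltnS ?leq_subr // coef_poly ltn_ord.
rewrite mulrA coefM; apply: eq_bigr => i _.
by rewrite coef_trunc_mul ?ltn_ord // coef_poly ltnS leq_subr.
Qed.

Lemma fps_mul1 (R : comUnitRingType) : left_id (@fps_one R) (@fps_mul R).
Proof.
move=> f; apply: fpsP => n /=.
rewrite big_ord_recl /= mul1r subn0 big1 ?addr0 // => i _.
by rewrite mul0r.
Qed.

Lemma fps_mulDl (R : comUnitRingType) :
  left_distributive (@fps_mul R) (@fps_add R).
Proof.
move=> f g h; apply: fpsP => n /=.
by rewrite -big_split /=; apply: eq_bigr => i _; rewrite mulrDl.
Qed.

Lemma fps_one_neq0 (R : comUnitRingType) : fps_one R != 0.
Proof.
by apply/eqP=> /(congr1 (fun f => coefs f 0)) /= /eqP; rewrite oner_eq0.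
Qed.

HB.instance Definition _ (R : comUnitRingType) :=
  GRing.Zmodule_isComNzRing.Build (fps R)
    (@fps_mulA R) (@fps_mulC R) (@fps_mul1 R) (@fps_mulDl R) (fps_one_neq0 R).

(* The first [n.+1] coefficients of the inverse of [f], from the recursion
   g_0 = f_0^-1,  g_(k+1) = - f_0^-1 * (f_1 g_k + f_2 g_(k-1) + ...). *)
Fixpoint fps_inv_seq (R : comUnitRingType) (f : fps R) (n : nat) : seq R :=
  if n is k.+1 then
    let s := fps_inv_seq f k in
    rcons s (- (coefs f 0)^-1 * \sum_(i < k.+1) coefs f i.+1 * s`_(k - i))
  else [:: (coefs f 0)^-1].

Definition fps_unit (R : comUnitRingType) : {pred fps R} :=
  fun f => coefs f 0 \is a GRing.unit.

Definition fps_inv (R : comUnitRingType) (f : fps R) : fps R :=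
  if coefs f 0 \is a GRing.unit then FPS (fun n => (fps_inv_seq f n)`_n) else f.

Lemma size_fps_inv_seq (R : comUnitRingType) (f : fps R) (n : nat) :
  size (fps_inv_seq f n) = n.+1.
Proof. by elim: n => //= n IHn; rewrite size_rcons IHn. Qed.

Lemma nth_fps_inv_seq (R : comUnitRingType) (f : fps R) (m n : nat) :
  (m <= n)%N -> (fps_inv_seq f n)`_m = (fps_inv_seq f m)`_m.
Proof.
elim: n => [|n IHn]; first by rewrite leqn0 => /eqP ->.
rewrite leq_eqVlt => /predU1P[-> //|]; rewrite ltnS => le_mn.
by rewrite /= nth_rcons size_fps_inv_seq ltnS le_mn IHn.
Qed.

Lemma fps_mulVx (R : comUnitRingType) :
  {in @fps_unit R, left_inverse 1 (@fps_inv R) *%R}.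
Proof.
move=> f; rewrite unfold_in => Uf; rewrite mulrC; apply: fpsP => n.
rewrite /fps_inv Uf /=; case: n => [|n]; first by rewrite big_ord1 /= divrr.
rewrite big_ord_recl subn0 /= nth_rcons size_fps_inv_seq ltnn eqxx.
rewrite mulrA mulrN divrr // mulN1r addrC; apply/eqP; rewrite subr_eq0.
apply/eqP/eq_bigr => i _.
by rewrite /bump /= add1n subSS (nth_fps_inv_seq _ (leq_subr _ _)).
Qed.

Lemma fps_unitPl (R : comUnitRingType) (f g : fps R) :
  g * f = 1 -> fps_unit f.
Proof.
move=> /(congr1 (fun h => coefs h 0)) /=; rewrite big_ord1 => gf1.
by apply/unitrPr; exists (coefs g 0); rewrite mulrC.
Qed.

Lemma fps_inv_out (R : comUnitRingType) :
  {in [predC @fps_unit R], @fps_inv R =1 id}.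
Proof. by move=> f; rewrite inE unfold_in /fps_inv => /negbTE ->. Qed.

HB.instance Definition _ (R : comUnitRingType) :=
  GRing.ComNzRing_hasMulInverse.Build (fps R)
    (@fps_mulVx R) (@fps_unitPl R) (@fps_inv_out R).

Definition fps_q : fps int := FPS (fun n => (n == 1)%:R).

(* The infinite product (a; b)_oo.  For [b] without constant term the factors
   with [t > n] do not affect the coefficient of q^n (lemma [qpochE]), so the
   product converges and its n-th coefficient is that of a finite product. *)
Definition qpoch (R : comUnitRingType) (a b : fps R) : fps R :=
  FPS (fun n => coefs (\prod_(t < n.+1) (1 - a * b ^+ t)) n).

Lemma coefs_exp_lt (R : comUnitRingType) (b : fps R) (t n : nat) :
  coefs b 0 = 0 -> (n < t)%N -> coefs (b ^+ t) n = 0.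
Proof.
move=> b0; elim: t n => // t IHt n lt_nt; rewrite exprS /= big1 // => i _.
case: i => [[|i] lt_i] /=; first by rewrite b0 mul0r.
rewrite IHt ?mulr0 //; move: lt_i lt_nt; rewrite !ltnS => lt_in le_nt.
by apply: leq_trans le_nt; rewrite ltn_subrL (leq_trans _ lt_in).
Qed.

Lemma qpochE (R : comUnitRingType) (a b : fps R) (n N : nat) :
  coefs b 0 = 0 -> (n < N)%N ->
  coefs (\prod_(t < N) (1 - a * b ^+ t)) n = coefs (qpoch a b) n.
Proof.
move=> b0; elim: N => // N IHN; rewrite ltnS leq_eqVlt => /predU1P[-> //|lt_nN].
rewrite big_ord_recr [X in coefs X]/= mulrBr mulr1 -IHN // mulrA.
rewrite /= [X in _ - X]big1 ?subr0 // => i _.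
by rewrite coefs_exp_lt ?mulr0 // (leq_ltn_trans (leq_subr _ _)).
Qed.

(* (a_1, ..., a_m; b)_oo *)
Definition qpochs (R : comUnitRingType) (s : seq (fps R)) (b : fps R) : fps R :=
  \prod_(a <- s) qpoch a b.

(* Main.v *)
Require Import Defs.
From mathcomp Require Import all_boot all_order all_algebra.
From mathcomp Require Import zify ring.

(* Put Q = q^28 and theta(x) = (x, Q/x; Q)_oo.  After clearing denominators the
   identity is the case
     theta(q^7)^2 theta(q^8)^2 - q theta(q^7)^2 theta(q^6)^2
       = theta(q) theta(q^13) theta(q^14)^2
   of the Weierstrass three-term relation.  By the Jacobi triple product,
   theta(q^(14-b)) (Q; Q)_oo = T_b := sum_k (-1)^k q^(14 k^2 + b k).  With
   G_c := sum_k q^(28 k^2 + c k), splitting the double series T_b T_c according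
   to the parity of m + n gives
     T_b T_c = G_(b+c) G_(b-c) - q^(14-b) G_(28-b-c) G_(28-b+c),
   and applied to T_7 T_6, T_8 T_7, T_13 T_0 and T_1 T_0, which involve only
   G_1, G_13, G_15 and G_27, this makes the relation a polynomial identity.
   The triple product comes from the q-binomial theorem, and all infinite sums
   and products are compared modulo q^M for every M. *)

Import Order.TTheory GRing.Theory Num.Theory.

Local Open Scope ring_scope.

(** * Congruence of power series modulo q^M *)

Section Truncation.
Variable R : comUnitRingType.
Implicit Types f g h : fps R.

Definition eqmodX (M : nat) f g := forall n, (n < M)%N -> coefs f n = coefs g n.

Lemma eqmodX_eq f g : (forall M, eqmodX M f g) -> f = g.
Proof. by move=> fg; apply: fpsP => n; apply: (fg n.+1). Qed.

Lemma eqmodX_refl M f : eqmodX M f f. Proof. by []. Qed.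

Lemma eqmodX_sym M f g : eqmodX M f g -> eqmodX M g f.
Proof. by move=> fg n /fg. Qed.

Lemma eqmodX_trans M f g h : eqmodX M f g -> eqmodX M g h -> eqmodX M f h.
Proof. by move=> fg gh n nM; rewrite fg ?gh. Qed.

Lemma eqmodXD M f1 f2 g1 g2 :
  eqmodX M f1 g1 -> eqmodX M f2 g2 -> eqmodX M (f1 + f2) (g1 + g2).
Proof. by move=> e1 e2 n nM /=; rewrite e1 ?e2. Qed.

Lemma eqmodXM M f1 f2 g1 g2 :
  eqmodX M f1 g1 -> eqmodX M f2 g2 -> eqmodX M (f1 * f2) (g1 * g2).
Proof.
move=> e1 e2 n nM /=; apply: eq_bigr => i _.
by rewrite e1 ?e2 //; have := ltn_ord i; lia.
Qed.

Lemma eqmodX_sum M (I : Type) (s : seq I) (P : pred I) (F G : I -> fps R) :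
  (forall i, P i -> eqmodX M (F i) (G i)) ->
  eqmodX M (\sum_(i <- s | P i) F i) (\sum_(i <- s | P i) G i).
Proof. by move=> FG; apply: (big_ind2 (eqmodX M)) => // *; apply: eqmodXD. Qed.

Lemma eqmodX_prod M (I : Type) (s : seq I) (P : pred I) (F G : I -> fps R) :
  (forall i, P i -> eqmodX M (F i) (G i)) ->
  eqmodX M (\prod_(i <- s | P i) F i) (\prod_(i <- s | P i) G i).
Proof. by move=> FG; apply: (big_ind2 (eqmodX M)) => // *; apply: eqmodXM. Qed.

Lemma eqmodX_exp M f g k : eqmodX M f g -> eqmodX M (f ^+ k) (g ^+ k).
Proof.
by move=> fg; elim: k => [|k IH]; rewrite ?expr0 // !exprS; apply: eqmodXM.
Qed.

Lemma eqmodX_prod1 M (I : Type) (s : seq I) (P : pred I) (F : I -> fps R)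
    (e : I -> nat) : (forall i, P i -> eqmodX M 1 (F i)) ->
  eqmodX M 1 (\prod_(i <- s | P i) F i ^+ e i).
Proof.
move=> F1; rewrite -[X in eqmodX M X](@big1_eq _ 1 *%R I s P).
by apply: eqmodX_prod => i /F1 /(eqmodX_exp _ _ _ (e i)); rewrite expr1n.
Qed.

Lemma eqmodX_unit M f g h :
  h \is a GRing.unit -> eqmodX M (h * f) (h * g) -> eqmodX M f g.
Proof.
move=> Uh /(eqmodXM M h^-1 _ h^-1 _ (eqmodX_refl _ _)).
by rewrite !mulKr.
Qed.

Lemma eqmodX_qpoch M N (a b : fps R) : coefs b 0 = 0 -> (M <= N)%N ->
  eqmodX M (\prod_(t < N) (1 - a * b ^+ t)) (qpoch a b).
Proof.
by move=> b0 MN n nM; rewrite qpochE // (leq_trans nM).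
Qed.

Lemma coefs_sum (I : Type) (s : seq I) (P : pred I) (F : I -> fps R) n :
  coefs (\sum_(i <- s | P i) F i) n = \sum_(i <- s | P i) coefs (F i) n.
Proof. by apply: (big_morph (fun f => coefs f n)). Qed.

Lemma fps_unitE f : (f \is a GRing.unit) = (coefs f 0 \is a GRing.unit).
Proof. by []. Qed.

Lemma qpoch_unit (a b : fps R) :
  coefs a 0 = 0 -> coefs b 0 = 0 -> qpoch a b \is a GRing.unit.
Proof.
move=> a0 b0; rewrite fps_unitE /= big_ord1 expr0 mulr1 /= a0 subr0.
exact: unitr1.
Qed.

End Truncation.

Arguments eqmodX_refl {R M f}.

(** * Gaussian binomials and the finite q-binomial theorem *)

Section QBinomial.
Variables (R : comNzRingType) (Q : R).

(** The Gaussian binomial coefficient, defined by Pascal's rule so that no division is required in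
    [R]. *)
Fixpoint gbin (n j : nat) : R :=
  match n, j with
  | _, 0 => 1
  | 0, _.+1 => 0
  | n'.+1, j'.+1 => gbin n' j'.+1 + Q ^+ (n' - j') * gbin n' j'
  end.

Lemma gbin0 n : gbin n 0 = 1. Proof. by case: n. Qed.

Lemma gbinS n j :
  gbin n.+1 j.+1 = gbin n j.+1 + Q ^+ (n - j) * gbin n j.
Proof. by []. Qed.

Lemma gbin_small n j : (n < j)%N -> gbin n j = 0.
Proof.
by elim: n j => [|n IH] [|j] //= nj; rewrite !IH ?mulr0 ?addr0 //; lia.
Qed.

Lemma gbinnn n : gbin n n = 1.
Proof.
by elim: n => //= n IH; rewrite gbin_small // IH subnn mulr1 add0r.
Qed.

Definition qfact n := \prod_(t < n) (1 - Q * Q ^+ t).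

Lemma qfact0 : qfact 0 = 1. Proof. exact: big_ord0. Qed.

Lemma qfactS n : qfact n.+1 = qfact n * (1 - Q ^+ n.+1).
Proof. by rewrite /qfact big_ord_recr -exprS. Qed.

(** Pascal's rule and induction on i + j reduce this to 1 - Q^(i+j+2) = (1 - Q^(i+1)) + Q^(i+1) (1 -
    Q^(j+1)). *)
Lemma gbin_qfact i j : gbin (i + j) j * (qfact i * qfact j) = qfact (i + j).
Proof.
have [n] := ubnP (i + j); elim: n i j => // n IH [|i] [|j] le_n.
- by rewrite gbin0 qfact0 !mul1r.
- by rewrite add0n gbinnn qfact0 !mul1r.
- by rewrite addn0 gbin0 qfact0 mulr1 mul1r.
rewrite addSn gbinS (_ : i + j.+1 - j = i.+1)%N; last lia.
have e1 := IH i j.+1 ltac:(lia).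
have := IH i.+1 j ltac:(lia); rewrite addSnnS => e2.
rewrite [qfact (i + j.+1).+1]qfactS -(addSn i j.+1) exprD.
transitivity ((1 - Q ^+ i.+1) * qfact (i + j.+1)
   + Q ^+ i.+1 * (1 - Q ^+ j.+1) * qfact (i + j.+1)).
  by rewrite -{1}e1 -e2 !qfactS; ring.
by ring.
Qed.

(** The homogeneous form, with [Y] in place of 1, allows Y = Q^N later and so avoids negative powers
    of Q. *)
Lemma qbinomial n (Y Z : R) :
  \prod_(t < n) (Y - Z * Q ^+ t) =
  \sum_(j < n.+1) (-1) ^+ j * gbin n j * Q ^+ 'C(j, 2) * Z ^+ j * Y ^+ (n - j).
Proof.
elim: n => [|n IH]; first by rewrite big_ord0 big_ord1 !expr0 !mulr1.
rewrite big_ord_recr /= IH mulrBr.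
rewrite [X in X * Y]big_ord_recl [RHS]big_ord_recl [X in _ - X * _]big_ord_recr /=.
rewrite [X in _ = _ + X]big_ord_recr /= !gbin0 !expr0 !subnn !subn0 /=.
rewrite [gbin n n.+1]gbin_small // !gbinnn.
rewrite (_ : 'C(n.+1, 2) = 'C(n, 2) + n)%N; last by rewrite binS bin1.
pose T (i : 'I_n) := (-1) ^+ i.+1 * gbin n i.+1 * Q ^+ 'C(i.+1, 2)
   * Z ^+ i.+1 * Y ^+ (n - i.+1) * Y.
(* By Pascal's rule the term of index i + 1 comes from [T], the old term i + 1 times Y, and from
   [U], the old term i times Z Q^n. *)
pose U (i : 'I_n) := (-1) ^+ i * gbin n i * Q ^+ 'C(i, 2) * Z ^+ i
   * Y ^+ (n - i) * (Z * Q ^+ n).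
rewrite [X in _ = _ + (X + _)](_ : _ = \sum_i (T i - U i)); last first.
  apply: eq_bigr => i _; rewrite /T /U /bump /= add1n binS bin1 subSS.
  have lt_in := ltn_ord i.
  have eQ : Q ^+ n = Q ^+ i * Q ^+ (n - i) by rewrite -exprD subnKC // ltnW.
  have eY : Y ^+ (n - i) = Y ^+ (n - i.+1) * Y.
    by rewrite -exprSr -subSn.
  by rewrite eQ eY !exprD !exprS; ring.
rewrite sumrB mulrDl !mulr_suml mulrDl mulr_suml /T /U.
under eq_bigr do rewrite /bump /= add1n.
rewrite !exprD !exprS; ring.
Qed.

End QBinomial.

Lemma prod_expr_ord (R : comNzRingType) (Q : R) N :
  \prod_(t < N) Q ^+ t = Q ^+ 'C(N, 2).
Proof.
elim: N => [|N IH]; first by rewrite big_ord0.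
by rewrite big_ord_recr /= IH -exprD binS bin1.
Qed.

(** The factor t = N + i is Q^N (1 - x Q^i). Since Q = x y, the factor t = N - 1 - i is - x
    Q^(N-1-i) (1 - y Q^i). *)
Lemma prod_two_sided (R : comNzRingType) (Q x y : R) N : x * y = Q ->
  \prod_(t < N + N) (Q ^+ N - x * Q ^+ t) =
  (- x) ^+ N * Q ^+ (N * N + 'C(N, 2)) *
  (\prod_(t < N) (1 - x * Q ^+ t) * \prod_(t < N) (1 - y * Q ^+ t)).
Proof.
move=> xyQ; rewrite big_split_ord /=.
have -> : \prod_(i < N) (Q ^+ N - x * Q ^+ (N + i)) =
    Q ^+ (N * N) * \prod_(t < N) (1 - x * Q ^+ t).
  under eq_bigr do rewrite exprD mulrCA -[X in X - _]mulr1 -mulrBr.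
  by rewrite big_split /= prodr_const card_ord exprM.
have -> : \prod_(i < N) (Q ^+ N - x * Q ^+ i) =
    (- x) ^+ N * Q ^+ 'C(N, 2) * \prod_(t < N) (1 - y * Q ^+ t).
  rewrite -prod_expr_ord.
  have -> : (- x) ^+ N = \prod_(t < N) (- x) by rewrite prodr_const card_ord.
  rewrite [LHS](reindex_inj rev_ord_inj) [X in _ * X * _](reindex_inj rev_ord_inj).
  rewrite -!big_split /=; apply: eq_bigr => i _.
  have -> : Q ^+ N = Q ^+ (N - i.+1) * (Q * Q ^+ i).
    by rewrite -exprS -exprD subnK.
  by rewrite -{2}xyQ; ring.
by rewrite exprD; ring.
Qed.

(** * Multiplication by powers of q *)

Lemma coefsM (R : comUnitRingType) (f g : fps R) n :
  coefs (f * g) n = \sum_(i < n.+1) coefs f i * coefs g (n - i).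
Proof. by []. Qed.

Lemma coefsB (R : comUnitRingType) (f g : fps R) n :
  coefs (f - g) n = coefs f n - coefs g n.
Proof. by []. Qed.

Lemma coefs_qM k (f : fps int) n :
  coefs (fps_q ^+ k * f) n = if (n < k)%N then 0 else coefs f (n - k).
Proof.
elim: k n => [|k IH] n; first by rewrite expr0 mul1r subn0.
rewrite exprS -mulrA coefsM big_ord_recl mul0r add0r.
case: n => [|n]; first by rewrite big_ord0.
rewrite big_ord_recl mul1r big1 ?addr0 => [|i _]; last by rewrite mul0r.
by rewrite /bump [(n.+1 - _)%N]subSS subn0 IH ltnS subSS.
Qed.

Lemma coefs_qX k n : coefs (fps_q ^+ k) n = (n == k)%:R.
Proof.
rewrite -[_ ^+ k]mulr1 coefs_qM /=; case: ltnP => [|kn]; first by case: ltngtP.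
by rewrite subn_eq0 eqn_leq kn andbT.
Qed.

Lemma fps_q_inj k (f g : fps int) : fps_q ^+ k * f = fps_q ^+ k * g -> f = g.
Proof.
move=> fg; apply: fpsP => n.
have : coefs (fps_q ^+ k * f) (n + k) = coefs (fps_q ^+ k * g) (n + k).
  by rewrite fg.
by rewrite !coefs_qM ltnNge leq_addl addnK.
Qed.

(** A factor q^k gains k in precision; for k >= M the truncated [M - k] is 0 and nothing is asked of
    f and g. *)
Lemma eqmodX_qM M k (f g : fps int) :
  eqmodX _ (M - k) f g -> eqmodX _ M (fps_q ^+ k * f) (fps_q ^+ k * g).
Proof.
move=> fg n nM; rewrite !coefs_qM; case: ltnP => // kn.
by apply: fg; lia.
Qed.

Lemma coefs_qX0 k : (0 < k)%N -> coefs (fps_q ^+ k) 0 = 0.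
Proof. by rewrite coefs_qX; case: k. Qed.

(** * Truncated theta series and the Jacobi triple product *)

Definition Q28 := fps_q ^+ 28.

Lemma Q28_0 : coefs Q28 0 = 0. Proof. exact: coefs_qX0. Qed.

Definition zbox (M : nat) : seq int := [seq i%:Z - M%:Z | i <- iota 0 (M + M).+1].

Lemma mem_zbox M (k : int) : (k \in zbox M) = (`|k| <= M)%N.
Proof.
apply/mapP/idP => [[i]|kM]; first by rewrite mem_iota => ? ->; lia.
by exists `|(k + M%:Z)%R|%N; [rewrite mem_iota|]; lia.
Qed.

Lemma zbox_uniq M : uniq (zbox M).
Proof. by rewrite map_inj_uniq ?iota_uniq // => i j; lia. Qed.

Lemma big_zbox M (F : int -> fps int) :
  \sum_(k <- zbox M) F k = \sum_(j < (M + M).+1) F (j%:Z - M%:Z).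
Proof.
rewrite big_map -(big_mkord xpredT (fun j => F (j%:Z - M%:Z))).
by rewrite /index_iota subn0.
Qed.

(** The absolute value only serves to land in [nat]: for c < A the form is nonnegative on
    integers. *)
Definition quad (A c : nat) (k : int) : nat := `|A%:Z * k ^+ 2 + c%:Z * k|.

Lemma quadE A c k : (c < A)%N -> (quad A c k)%:Z = A%:Z * k ^+ 2 + c%:Z * k.
Proof.
move=> cA; rewrite /quad gez0_abs // expr2.
have [k0|k0] : 0 <= k \/ k < 0 by lia.
- by nia.
- have kk : k * k >= - k by nia.
  by nia.
Qed.

(** This puts every index of exponent below M inside [zbox M], so that the box is large enough
    modulo q^M. *)
Lemma quad_ge A c k : (c < A)%N -> (`|k| <= quad A c k)%N.
Proof.
move=> cA; rewrite -lez_nat quadE // expr2.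
have [k0|k0] : 0 <= k \/ k < 0 by lia.
- by nia.
- have kk : k * k >= - k by nia.
  by nia.
Qed.

(* Over all of Z rather than [- M, M] these are sum (-1)^k q^(14 k^2 + b k) and
   sum q^(28 k^2 + c k); the omitted terms vanish modulo q^M when b < 14, c < 28. *)
Definition theta_sum M b :=
  \sum_(k <- zbox M) (-1) ^+ `|k|%N * fps_q ^+ quad 14 b k.
Definition gauss_sum M c := \sum_(k <- zbox M) fps_q ^+ quad 28 c k.

(** This is (x, Q/x; Q)_oo at x = q^(14-b); indexing by the distance to 14 makes b the linear
    coefficient of the exponents 14 k^2 + b k. *)
Definition theta b :=
  qpoch (fps_q ^+ (14 + b)) Q28 * qpoch (fps_q ^+ (14 - b)) Q28.

(** This is the q-binomial theorem for 2N factors at Y = Q^N, Z = q^(14+b), with j = N + k;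
    regularity of q allows cancelling the common monomial. *)
Lemma finite_triple_product (R : comNzRingType) (q Q : R) N b :
  GRing.lreg q -> Q = q ^+ 28 -> (b < 14)%N ->
  \prod_(t < N) (1 - q ^+ (14 + b) * Q ^+ t) *
  \prod_(t < N) (1 - q ^+ (14 - b) * Q ^+ t) =
  \sum_(j < (N + N).+1) (-1) ^+ `|j%:Z - N%:Z|%N * gbin _ Q (N + N) j *
     q ^+ quad 14 b (j%:Z - N%:Z).
Proof.
move=> qreg defQ b14.
have xyQ : q ^+ (14 + b) * q ^+ (14 - b) = Q.
  by rewrite -exprD defQ; congr (_ ^+ _); lia.
have QX m : Q ^+ m = q ^+ (28 * m) by rewrite defQ exprM.
have := prod_two_sided _ _ _ _ N xyQ; rewrite qbinomial.
set P := _ * \prod_(t < N) _ => eP.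
(* [K] is the exponent of q in the monomial that [prod_two_sided] extracts. *)
pose K := ((14 + b) * N + 28 * (N * N + 'C(N, 2)))%N.
apply: (lregX (n := K) qreg); apply: (@lreg_sign _ N).
transitivity ((- q ^+ (14 + b)) ^+ N * Q ^+ (N * N + 'C(N, 2)) * P).
  by rewrite [(- q ^+ _) ^+ N]exprNn QX [q ^+ K]exprD !exprM; ring.
rewrite -eP !mulr_sumr; apply: eq_bigr => j _.
have le_j : (j <= N + N)%N by rewrite -ltnS.
set k := j%:Z - N%:Z.
have -> : (-1) ^+ j = (-1) ^+ N * (-1) ^+ `|k|%N :> R.
  rewrite -exprD -signr_odd -[RHS]signr_odd; congr (_ ^+ _).
  by rewrite /k; lia.
(* The left side is the exponent of q in the j-th q-binomial term; completing the square about j = N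
   leaves 14 k^2 + b k beyond K. *)
have eK : (28 * 'C(j, 2) + (14 + b) * j + 28 * (N * (N + N - j))
    = K + quad 14 b k)%N.
  have bin2E i : (28 * 'C(i, 2) + 14 * i = 14 * (i * i))%N.
    by have := mul_bin_diag i 1; rewrite bin1; case: i => [|i] /=; lia.
  have := quadE 14 b k b14; rewrite /K /k expr2.
  have := bin2E j; have := bin2E N.
  have : (N * (N + N - j) + N * j = N * (N + N))%N.
    by rewrite -mulnDr subnK.
  by lia.
set g := gbin _ _ _ _.
have collect A B C : Q ^+ 'C(j, 2) = q ^+ A -> (q ^+ (14 + b)) ^+ j = q ^+ B ->
    (Q ^+ N) ^+ (N + N - j) = q ^+ C ->
    (-1) ^+ N * (-1) ^+ `|k|%N * g * Q ^+ 'C(j, 2) * (q ^+ (14 + b)) ^+ j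
      * (Q ^+ N) ^+ (N + N - j) = (-1) ^+ N * (-1) ^+ `|k|%N * g * q ^+ (A + B + C).
  by move=> -> -> ->; rewrite !exprD; ring.
have QNX : (Q ^+ N) ^+ (N + N - j) = q ^+ (28 * (N * (N + N - j))).
  by rewrite -exprM; apply: QX.
rewrite (collect _ _ _ (QX _) (esym (exprM _ _ _)) QNX).
by rewrite eK (exprD q K); ring.
Qed.

(** In [gbin_qfact] all three factorials agree with (Q; Q)_oo modulo q^L, and one copy of this unit
    cancels. *)
Lemma gbin_limit (R : comUnitRingType) (Q : fps R) L i j :
  coefs Q 0 = 0 -> (L <= i)%N -> (L <= j)%N ->
  eqmodX _ L (gbin _ Q (i + j) j * qpoch Q Q) 1.
Proof.
move=> Q0 Li Lj; set P := qpoch Q Q.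
have qf n : (L <= n)%N -> eqmodX _ L (qfact _ Q n) P.
  by move=> Ln; apply: eqmodX_qpoch.
have UP : P \is a GRing.unit by apply: qpoch_unit.
apply: (eqmodX_unit _ _ _ _ _ UP); rewrite mulr1 mulrCA.
apply: eqmodX_trans (qf _ (leq_trans Li (leq_addr j i))).
rewrite -gbin_qfact; apply: eqmodXM => //.
by apply: eqmodX_sym; apply: eqmodXM; apply: qf.
Qed.

Lemma lreg_fps_q : GRing.lreg fps_q.
Proof. by move=> f g; have := fps_q_inj 1 f g; rewrite expr1. Qed.

Lemma jacobi_triple_product M b : (b < 14)%N ->
  eqmodX _ M (theta b * qpoch Q28 Q28) (theta_sum M b).
Proof.
move=> b14; rewrite /theta /theta_sum.
have := finite_triple_product _ _ _ M _ lreg_fps_q (erefl Q28) b14.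
move: Q28_0; generalize Q28 => Q Q0 fin.
have lim a : eqmodX _ M (qpoch a Q) (\prod_(t < M) (1 - a * Q ^+ t)).
  by apply: eqmodX_sym; apply: eqmodX_qpoch.
apply: (eqmodX_trans _ _ _ _ _
  (eqmodXM _ _ _ _ _ _ (eqmodXM _ _ _ _ _ _ (lim _) (lim _)) eqmodX_refl)).
rewrite {}fin mulr_suml big_zbox; apply: eqmodX_sum => j _.
set k := j%:Z - M%:Z; set d := quad 14 b k.
have -> : (-1) ^+ `|k|%N * gbin _ Q (M + M) j * fps_q ^+ d * qpoch Q Q =
  (-1) ^+ `|k|%N * (fps_q ^+ d * (gbin _ Q (M + M) j * qpoch Q Q)) by ring.
apply: eqmodXM => //; rewrite -[X in eqmodX _ _ _ X]mulr1.
(* The factor q^d lowers the precision required of the binomial to M - d. As d >= |k|, both j = M +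
   k and 2M - j = M - k are at least M - d. *)
apply: eqmodX_qM.
have le_j : (j <= M + M)%N by rewrite -ltnS.
have := quad_ge 14 b k b14; rewrite -/d => dk.
have := gbin_limit _ Q (M - d) (M + M - j) j Q0; rewrite subnK //.
by apply; rewrite /k in dk; lia.
Qed.

(** * Products of two theta series *)

Definition zbox2 M := [seq (k, l) | k <- zbox M, l <- zbox M].

Lemma mem_zbox2 M (p : int * int) :
  (p \in zbox2 M) = (`|p.1| <= M)%N && (`|p.2| <= M)%N.
Proof.
rewrite -!mem_zbox; case: p => k l /=.
by apply/allpairsP/andP => [[[k' l'] /= [? ? [-> ->]]]|[kM lM]]; last exists (k, l).
Qed.

Lemma zbox2_uniq M : uniq (zbox2 M).
Proof. by apply: allpairs_uniq; rewrite ?zbox_uniq // => -[? ?] [? ?]. Qed.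

Lemma sum_zbox2 M (F G : int -> fps int) :
  (\sum_(k <- zbox M) F k) * (\sum_(k <- zbox M) G k) =
  \sum_(p <- zbox2 M) F p.1 * G p.2.
Proof. by rewrite big_distrlr big_allpairs_dep. Qed.

(** Selecting terms by exponent prepares for changes of variables, which preserve exponents but not
    boxes. *)
Lemma eqmodX_filter M (I : Type) (s : seq I) (F : I -> fps int) (W : I -> nat) :
  eqmodX _ M (\sum_(p <- s) F p * fps_q ^+ W p)
             (\sum_(p <- s | (W p < M)%N) F p * fps_q ^+ W p).
Proof.
rewrite [X in eqmodX _ _ _ X]big_mkcond; apply: eqmodX_sum => p _.
case: ifP => // /negbT; rewrite -leqNgt => MW.
by move=> n nM; rewrite mulrC coefs_qM (leq_trans nM MW).
Qed.

(** Here h is a bijection from Z^2 onto [E] turning [W] into [W']; the last two hypotheses make the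
    sums independent of the box. *)
Lemma reindex_zbox2 M (W W' : int * int -> nat) (E : pred (int * int))
    (h : int * int -> int * int) (F : int * int -> fps int) :
  injective h -> (forall p, W (h p) = W' p) -> (forall p, E (h p)) ->
  (forall p, E p -> exists r, h r = p) ->
  (forall p, (W p < M)%N -> p \in zbox2 M) ->
  (forall p, (W' p < M)%N -> p \in zbox2 M) ->
  \sum_(p <- zbox2 M | (W p < M)%N && E p) F p =
  \sum_(p <- zbox2 M | (W' p < M)%N) F (h p).
Proof.
move=> hI hW hE hS WM W'M.
rewrite -big_filter -[RHS]big_filter -(big_map h xpredT F); apply: perm_big.
apply: uniq_perm; rewrite ?map_inj_uniq ?filter_uniq ?zbox2_uniq // => p.
rewrite mem_filter; apply/andP/mapP => [[/andP[pM /hS[r rp]] _]|[r]].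
  exists r => //; rewrite mem_filter -hW rp pM W'M // -hW rp //.
rewrite mem_filter -hW => /andP[rM _] ->; split; last exact: WM.
by rewrite rM hE.
Qed.

(* Terms (m, n) with m + n even are parametrised by (k + l, k - l), the others by
   (- k - l - 1, l - k); in both cases the exponent separates in k and l. *)
Lemma theta_sum_mul M b c : (c < b)%N -> (b < 14)%N ->
  eqmodX _ M (theta_sum M b * theta_sum M c)
    (gauss_sum M (b + c) * gauss_sum M (b - c)
     - fps_q ^+ (14 - b) * (gauss_sum M (28 - b - c) * gauss_sum M (28 - b + c))).
Proof.
move=> cb b14; rewrite /theta_sum /gauss_sum !sum_zbox2 mulr_sumr.
pose W (p : int * int) := (quad 14 b p.1 + quad 14 c p.2)%N.
pose W0 (p : int * int) := (quad 28 (b + c) p.1 + quad 28 (b - c) p.2)%N.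
pose W1 (p : int * int) :=
  (14 - b + (quad 28 (28 - b - c) p.1 + quad 28 (28 - b + c) p.2))%N.
pose s (p : int * int) : fps int := (-1) ^+ (`|p.1| + `|p.2|)%N.
pose even (p : int * int) := ~~ odd (`|p.1| + `|p.2|)%N.
have WM p : (W p < M)%N -> p \in zbox2 M.
  rewrite mem_zbox2 /W; have := quad_ge 14 b p.1 b14.
  by have := quad_ge 14 c p.2; lia.
have W0M p : (W0 p < M)%N -> p \in zbox2 M.
  rewrite mem_zbox2 /W0; have := quad_ge 28 (b + c) p.1.
  by have := quad_ge 28 (b - c) p.2; lia.
have W1M p : (W1 p < M)%N -> p \in zbox2 M.
  rewrite mem_zbox2 /W1; have := quad_ge 28 (28 - b - c) p.1.
  by have := quad_ge 28 (28 - b + c) p.2; lia.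
pose h0 (p : int * int) : int * int := (p.1 + p.2, p.1 - p.2).
pose h1 (p : int * int) : int * int := (- p.1 - p.2 - 1, p.2 - p.1).
have Wh0 p : W (h0 p) = W0 p.
  apply/eqP; rewrite -eqz_nat /W /W0 /h0 !PoszD !quadE; try lia.
  have -> : (b - c)%N%:Z = b%:Z - c%:Z by lia.
  by rewrite PoszD; apply/eqP; case: p => k l /=; ring.
have Wh1 p : W (h1 p) = W1 p.
  apply/eqP; rewrite -eqz_nat /W /W1 /h1 !PoszD !quadE; try lia.
  have -> : (28 - b - c)%N%:Z = 28%:Z - b%:Z - c%:Z by lia.
  have -> : (28 - b + c)%N%:Z = 28%:Z - b%:Z + c%:Z by lia.
  have -> : (14 - b)%N%:Z = 14%:Z - b%:Z by lia.
  by apply/eqP; case: p => k l /=; ring.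
have -> : \sum_(p <- zbox2 M) (-1) ^+ `|p.1|%N * fps_q ^+ quad 14 b p.1
      * ((-1) ^+ `|p.2|%N * fps_q ^+ quad 14 c p.2)
    = \sum_(p <- zbox2 M) s p * fps_q ^+ W p.
  by apply: eq_bigr => p _; rewrite /s /W !exprD; ring.
have -> : \sum_(p <- zbox2 M) fps_q ^+ quad 28 (b + c) p.1
      * fps_q ^+ quad 28 (b - c) p.2 = \sum_(p <- zbox2 M) 1 * fps_q ^+ W0 p.
  by apply: eq_bigr => p _; rewrite /W0 exprD mul1r.
rewrite -sumrN.
have -> : \sum_(p <- zbox2 M) - (fps_q ^+ (14 - b)
      * (fps_q ^+ quad 28 (28 - b - c) p.1
      * fps_q ^+ quad 28 (28 - b + c) p.2))
    = \sum_(p <- zbox2 M) -1 * fps_q ^+ W1 p.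
  by apply: eq_bigr => p _; rewrite /W1 !exprD mulN1r.
apply: (eqmodX_trans _ _ _ _ _ (eqmodX_filter _ _ _ _ _)).
apply: eqmodX_sym.
apply: (eqmodX_trans _ _ _ _ _
  (eqmodXD _ _ _ _ _ _ (eqmodX_filter _ _ _ _ _) (eqmodX_filter _ _ _ _ _))).
rewrite [X in eqmodX _ _ _ X](bigID even) /=.
rewrite (reindex_zbox2 M W W0 even h0) //; first last.
- by move=> [m n] Emn; exists (((m + n) %/ 2)%Z, ((m - n) %/ 2)%Z);
  rewrite /h0 /=; congr (_, _); move: Emn; rewrite /even /=; lia.
- by move=> [m n]; rewrite /even /h0 /=; lia.
- by move=> [m n] [m' n'] []; rewrite /h0 /= => ? ?; congr (_, _); lia.
rewrite (reindex_zbox2 M W W1 (predC even) h1) //; first last.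
(* Solving m = - k - l - 1, n = l - k gives 2k = - m - n - 1 and 2l = n - m - 1; both are even
   because m + n is odd. *)
- by move=> [m n] Emn; exists (((- m - n - 1) %/ 2)%Z, ((n - m - 1) %/ 2)%Z);
  rewrite /h1 /=; congr (_, _); move: Emn; rewrite /even /=; lia.
- by move=> [m n]; rewrite /even /h1 /=; lia.
- by move=> [m n] [m' n'] []; rewrite /h1 /= => ? ?; congr (_, _); lia.
move=> n _; congr (coefs (_ + _) n); apply: eq_bigr => p _.
  rewrite Wh0 /s -signr_odd (_ : odd _ = false) //.
  by rewrite /h0 /=; lia.
rewrite Wh1 /s -signr_odd (_ : odd _ = true) //.
by rewrite /h1 /=; lia.
Qed.

(** * The three-term relation *)

Lemma theta_identity :
  (theta 7 * theta 6) ^+ 2 =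
  theta 13 * theta 1 * theta 0 ^+ 2 + fps_q * (theta 7 * theta 8) ^+ 2.
Proof.
set P := qpoch Q28 Q28.
have UP : P \is a GRing.unit by apply: qpoch_unit; exact: Q28_0.
pose t b := theta b * P.
(* Each product has four theta factors, and each of them takes one (Q; Q)_oo in the triple
   product. *)
apply: (mulIr (unitrX 4 UP)); apply: eqmodX_eq => M.
have tt b c : (c < b)%N -> (b < 14)%N -> eqmodX _ M (t b * t c)
    (gauss_sum M (b + c) * gauss_sum M (b - c)
     - fps_q ^+ (14 - b) * (gauss_sum M (28 - b - c) * gauss_sum M (28 - b + c))).
  move=> cb b14; apply: eqmodX_trans (theta_sum_mul M b c cb b14).
  by apply: eqmodXM; apply: jacobi_triple_product; lia.
pose G := gauss_sum M.
have e76 : eqmodX _ M (t 7 * t 6) (G 13 * G 1 - fps_q ^+ 7 * (G 15 * G 27)) :=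
  tt 7 6 isT isT.
have e130 : eqmodX _ M (t 13 * t 0) (G 13 * G 13 - fps_q ^+ 1 * (G 15 * G 15)) :=
  tt 13 0 isT isT.
have e10 : eqmodX _ M (t 1 * t 0) (G 1 * G 1 - fps_q ^+ 13 * (G 27 * G 27)) :=
  tt 1 0 isT isT.
have e87 : eqmodX _ M (t 8 * t 7) (G 15 * G 1 - fps_q ^+ 6 * (G 13 * G 27)) :=
  tt 8 7 isT isT.
have -> : (theta 7 * theta 6) ^+ 2 * P ^+ 4 = (t 7 * t 6) ^+ 2.
  by rewrite /t; move: (theta 7) (theta 6) (P) => t7 t6 p; ring.
have -> : (theta 13 * theta 1 * theta 0 ^+ 2
      + fps_q * (theta 7 * theta 8) ^+ 2) * P ^+ 4
    = (t 13 * t 0) * (t 1 * t 0) + fps_q * (t 8 * t 7) ^+ 2.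
  rewrite /t; move: (theta 13) (theta 1) (theta 0) (theta 7) (theta 8) (P) fps_q.
  by move=> t13 t1 t0 t7 t8 p q; ring.
apply: (eqmodX_trans _ _ _ _ _ (eqmodX_exp _ _ _ _ 2 e76)).
apply: eqmodX_sym.
apply: (eqmodX_trans _ _ _ _ _ (eqmodXD _ _ _ _ _ _ (eqmodXM _ _ _ _ _ _ e130 e10)
  (eqmodXM _ _ _ _ _ _ eqmodX_refl (eqmodX_exp _ _ _ _ 2 e87)))).
(* This is Brahmagupta's identity (x^2 - q y^2)(z^2 - q w^2) + q (y z - x w)^2 = (x z - q y w)^2 at
   x = G_13, y = G_15, z = G_1, w = q^6 G_27. *)
rewrite [X in eqmodX _ _ X](_ : _ =
  (G 13 * G 1 - fps_q ^+ 7 * (G 15 * G 27)) ^+ 2) //.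
by move: (G 13) (G 1) (G 15) (G 27) fps_q => g13 g1 g15 g27 q; ring.
Qed.

(** * Generating functions of coloured partitions *)

Lemma subr_qX_unit s : (0 < s)%N -> 1 - fps_q ^+ s \is a GRing.unit.
Proof. by move=> s0; rewrite fps_unitE /= coefs_qX0 // subr0 unitr1. Qed.

Lemma prod_coloured_part (c : nat -> nat) n (F : nat -> fps int) :
  \prod_(p : coloured_part c n) F (tag p).+1 = \prod_(i < n) F i.+1 ^+ c i.+1.
Proof.
transitivity (\prod_(i < n) \prod_(j < c i.+1) F i.+1).
  by rewrite (sig_big_dep xpredT (fun _ _ => true) (fun (i : 'I_n) _ => F i.+1)).
by apply: eq_bigr => i _; rewrite prodr_const card_ord.
Qed.

(** Modulo q^(n+1) each 1/(1 - q^s) is a geometric sum of n + 1 terms; expanding the product over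
    coloured parts gives one monomial per choice of multiplicities. *)
Lemma coefs_coloured_partitions (c : nat -> nat) n :
  coefs (\prod_(i < n) (1 - fps_q ^+ i.+1) ^+ c i.+1)^-1 n =
  #|coloured_partitions c n|%:Z.
Proof.
set D := \prod_(i < n) _.
have UD : D \is a GRing.unit.
  by apply: rpred_prod => i _; apply: unitrX; apply: subr_qX_unit.
pose E := \prod_(p : coloured_part c n) \sum_(j < n.+1) fps_q ^+ ((tag p).+1 * j).
have ED : eqmodX _ n.+1 D^-1 E.
  apply: (eqmodX_unit _ _ _ _ _ UD); rewrite divrr //.
  rewrite /E (prod_coloured_part c n (fun s => \sum_(j < n.+1) fps_q ^+ (s * j))).
  rewrite -big_split /=; under [X in eqmodX _ _ _ X]eq_bigr do rewrite -exprMn.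
  apply: eqmodX_prod1 => i _.
  under eq_bigr do rewrite exprM.
  rewrite -opprB mulNr -subrX1 opprB -exprM => k kn /=.
  rewrite coefs_qX [k == (_ * _)%N](_ : _ = false) ?subr0 //; apply/negbTE.
  by rewrite neq_ltn (leq_trans kn) // leq_pmull.
rewrite ED // /E bigA_distr_bigA coefs_sum.
under eq_bigr => m _ do rewrite -expr_sum coefs_qX eq_sym.
rewrite -natr_sum -natz -sum1_card [in RHS]big_mkcond; congr (_%:R).
by apply: eq_bigr => m _; rewrite inE; case: eqP.
Qed.

Lemma big_ord_mul (m N : nat) (F : nat -> fps int) :
  \prod_(s < m * N) F s = \prod_(t < N) \prod_(r < m) F (m * t + r)%N.
Proof.
elim: N => [|N IH]; first by rewrite muln0 !big_ord0.
by rewrite mulnS addnC big_split_ord big_ord_recr /= IH.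
Qed.

(** Factors with s > n are 1 modulo q^(n+1), so the product may run up to m (n + 1) and be grouped
    by residue. *)
Lemma prod_periodic (m n : nat) (c : nat -> nat) :
  (0 < m)%N -> c 0%N = 0%N -> (forall t r, c (m * t + r)%N = c r) ->
  eqmodX _ n.+1 (\prod_(i < n) (1 - fps_q ^+ i.+1) ^+ c i.+1)
    (\prod_(r < m) qpoch (fps_q ^+ r) (fps_q ^+ m) ^+ c r).
Proof.
move=> m0 c0 cP; pose F s := (1 - fps_q ^+ s) ^+ c s.
(* The added factor s = 0 has base 1 - q^0 = 0 but exponent c 0 = 0, hence equals 1. *)
have -> : \prod_(i < n) (1 - fps_q ^+ i.+1) ^+ c i.+1 = \prod_(i < n.+1) F i.
  by rewrite big_ord_recl /F c0 expr0 mul1r.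
have leq_mn : (n.+1 <= m * n.+1)%N by nia.
apply: (eqmodX_trans _ _ _ (\prod_(s < m * n.+1) F s)).
  rewrite -(subnKC leq_mn) big_split_ord /= -[X in eqmodX _ _ X _]mulr1.
  apply: eqmodXM => //; apply: eqmodX_prod1 => i _ k kn /=.
  by rewrite coefs_qX [k == (_ + _)%N](_ : _ = false) ?subr0 //; lia.
rewrite big_ord_mul exchange_big /=; apply: eqmodX_prod => r _.
under eq_bigr do rewrite /F cP addnC exprD exprM.
rewrite prodrXl; apply: eqmodX_exp; apply: eqmodX_qpoch => //.
exact: coefs_qX0.
Qed.

Lemma coloured_partitions_genfun (m : nat) (c : nat -> nat) n :
  (0 < m)%N -> c 0%N = 0%N -> (forall t r, c (m * t + r)%N = c r) ->
  coefs (\prod_(r < m) qpoch (fps_q ^+ r) (fps_q ^+ m) ^+ c r)^-1 n =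
  #|coloured_partitions c n|%:Z.
Proof.
move=> m0 c0 cP; rewrite -coefs_coloured_partitions.
set D := \prod_(i < n) _; set D' := \prod_(r < m) _.
have UD : D \is a GRing.unit.
  by apply: rpred_prod => i _; apply: unitrX; apply: subr_qX_unit.
have DD' : eqmodX _ n.+1 D D' by apply: prod_periodic.
have UD' : D' \is a GRing.unit by move: UD; rewrite !fps_unitE DD'.
suff : eqmodX _ n.+1 D'^-1 D^-1 by apply.
apply: (eqmodX_unit _ _ _ _ _ UD'); rewrite divrr // -(divrr UD).
by apply: eqmodXM.
Qed.

(** * The three-term relation in reciprocal form *)

Lemma theta_unit b : (b < 14)%N -> theta b \is a GRing.unit.
Proof.
move=> b14; rewrite unitrM; apply/andP.
by split; apply: (qpoch_unit _ _ _ _ Q28_0); apply: coefs_qX0; lia.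
Qed.

(* In the application [A], [B], [t7], [t14] are the theta functions at q^6, q^8,
   q^7, q^14, and [t1] is the product of those at q and q^13. *)
Lemma divr_three_term (R : comUnitRingType) (q A B t7 t14 t1 : R) :
  A \is a GRing.unit -> B \is a GRing.unit -> t7 \is a GRing.unit ->
  t14 \is a GRing.unit -> t1 \is a GRing.unit ->
  (t7 * B) ^+ 2 = t1 * t14 ^+ 2 + q * (t7 * A) ^+ 2 ->
  1 / (A ^+ 2 * t14 ^+ 2 * t1) - q / (B ^+ 2 * t14 ^+ 2 * t1)
  = 1 / (A * t7 * B) ^+ 2.
Proof.
move=> UA UB U7 U14 U1 eqn.
pose X := (A * t7 * B) ^+ 2 * (t14 ^+ 2 * t1).
have UX : X \is a GRing.unit by rewrite !(unitrM, unitrX) // UA UB U7 U14 U1.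
have cancel_div a d e : d \is a GRing.unit -> X = d * e -> a / d * X = a * e.
  by move=> Ud ->; rewrite mulrA divrK.
apply: (mulIr UX); rewrite mulrBl.
rewrite (cancel_div 1 (A ^+ 2 * t14 ^+ 2 * t1) ((t7 * B) ^+ 2)); first last.
- by rewrite /X; ring.
- by rewrite !unitrM ?(UA, UB, U14, U1).
rewrite (cancel_div q (B ^+ 2 * t14 ^+ 2 * t1) ((t7 * A) ^+ 2)); first last.
- by rewrite /X; ring.
- by rewrite !unitrM ?(UA, UB, U14, U1).
rewrite (cancel_div 1 ((A * t7 * B) ^+ 2) (t14 ^+ 2 * t1)); first last.
- by [].
- by rewrite unitrX // !unitrM ?(UA, UB, U7).
by rewrite !mul1r eqn; ring.
Qed.

Lemma reciprocal_theta_identity :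
  1 / (theta 8 ^+ 2 * theta 0 ^+ 2 * (theta 13 * theta 1))
  - fps_q / (theta 6 ^+ 2 * theta 0 ^+ 2 * (theta 13 * theta 1))
  = 1 / (theta 8 * theta 7 * theta 6) ^+ 2.
Proof.
apply: divr_three_term theta_identity; try exact: theta_unit.
by rewrite unitrM; apply/andP; split; apply: theta_unit.
Qed.

(** * The three colourings and the theorem *)

Lemma colours1_periodic t r : colours1 (28 * t + r) = colours1 r.
Proof. by rewrite /colours1 /pm28 mulnC !modnMDl. Qed.

Lemma colours2_periodic t r : colours2 (28 * t + r) = colours2 r.
Proof. by rewrite /colours2 /pm28 mulnC !modnMDl. Qed.

Lemma colours3_periodic t r : colours3 (28 * t + r) = colours3 r.
Proof. by rewrite /colours3 /pm28 mulnC !modnMDl. Qed.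

Lemma prod_colours1 (R : comNzRingType) (w : nat -> R) :
  \prod_(r < 28) w r ^+ colours1 r =
  (\prod_(r <- [:: 6; 22]) w r) ^+ 2 * w 14 ^+ 4
    * \prod_(r <- [:: 1; 27; 13; 15]) w r.
Proof.
rewrite -(big_mkord xpredT (fun r => w r ^+ colours1 r)) unlock.
by rewrite /= /colours1 /pm28 /=; ring.
Qed.

Lemma prod_colours2 (R : comNzRingType) (w : nat -> R) :
  \prod_(r < 28) w r ^+ colours2 r =
  (\prod_(r <- [:: 8; 20]) w r) ^+ 2 * w 14 ^+ 4
    * \prod_(r <- [:: 1; 27; 13; 15]) w r.
Proof.
rewrite -(big_mkord xpredT (fun r => w r ^+ colours2 r)) unlock.
by rewrite /= /colours2 /pm28 /=; ring.
Qed.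

Lemma prod_colours3 (R : comNzRingType) (w : nat -> R) :
  \prod_(r < 28) w r ^+ colours3 r =
  (\prod_(r <- [:: 6; 22; 7; 21; 8; 20]) w r) ^+ 2.
Proof.
rewrite -(big_mkord xpredT (fun r => w r ^+ colours3 r)) unlock.
by rewrite /= /colours3 /pm28 /=; ring.
Qed.

Definition residue_prod (c : nat -> nat) : fps int :=
  \prod_(r < 28) qpoch (fps_q ^+ r) (fps_q ^+ 28) ^+ c r.

Lemma residue_prod_identity :
  1 / residue_prod colours1 - fps_q / residue_prod colours2
  = 1 / residue_prod colours3.
Proof.
(* [th] pairs opposite residues modulo 28; [th w 0] is the square of w 14, so the four colours of 14
   give [th w 0 ^+ 2]. *)
pose th (w : nat -> fps int) b := w (14 + b)%N * w (14 - b)%N.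
have theta1 (w : nat -> fps int) : \prod_(r < 28) w r ^+ colours1 r =
    th w 8 ^+ 2 * th w 0 ^+ 2 * (th w 13 * th w 1).
  by rewrite prod_colours1 unlock /th /=; ring.
have theta2 (w : nat -> fps int) : \prod_(r < 28) w r ^+ colours2 r =
    th w 6 ^+ 2 * th w 0 ^+ 2 * (th w 13 * th w 1).
  by rewrite prod_colours2 unlock /th /=; ring.
have theta3 (w : nat -> fps int) : \prod_(r < 28) w r ^+ colours3 r =
    (th w 8 * th w 7 * th w 6) ^+ 2.
  by rewrite prod_colours3 unlock /th /=; ring.
pose w r := qpoch (fps_q ^+ r) Q28.
rewrite /residue_prod (theta1 w) (theta2 w) (theta3 w).
exact: reciprocal_theta_identity.
Qed.

Theorem theorem3p1 :
  (forall n : nat, (1 <= n)%N ->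
     (C1 n)%:Z - (C2 (n - 1)%N)%:Z - (C3 n)%:Z = 0)
  /\
  (let q := fps_q in
   1 / (qpochs [:: q ^+ 6; q ^+ 22] (q ^+ 28) ^+ 2
        * qpoch (q ^+ 14) (q ^+ 28) ^+ 4
        * qpochs [:: q; q ^+ 27; q ^+ 13; q ^+ 15] (q ^+ 28))
   - q / (qpochs [:: q ^+ 8; q ^+ 20] (q ^+ 28) ^+ 2
          * qpoch (q ^+ 14) (q ^+ 28) ^+ 4
          * qpochs [:: q; q ^+ 27; q ^+ 13; q ^+ 15] (q ^+ 28))
   = 1 / qpochs [:: q ^+ 6; q ^+ 22; q ^+ 7; q ^+ 21; q ^+ 8; q ^+ 20]
                (q ^+ 28) ^+ 2).
Proof.
split=> [[//|n] _ | q]; last first.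
  pose w r := qpoch (fps_q ^+ r) (fps_q ^+ 28).
  have := residue_prod_identity; rewrite /residue_prod.
  rewrite (prod_colours1 _ w) (prod_colours2 _ w) (prod_colours3 _ w).
  have qs s : \prod_(r <- s) w r = qpochs [seq fps_q ^+ r | r <- s] (fps_q ^+ 28).
    by rewrite /qpochs big_map.
  by rewrite (qs [:: 6; 22]) (qs [:: 8; 20]) (qs [:: 1; 27; 13; 15])
             (qs [:: 6; 22; 7; 21; 8; 20]).
have coefE c k : c 0 = 0 -> (forall t r, c (28 * t + r) = c r) ->
    coefs (residue_prod c)^-1 k = #|coloured_partitions c k|%:Z.
  exact: coloured_partitions_genfun.
have coef2 : coefs (fps_q * (residue_prod colours2)^-1) n.+1 = (C2 n)%:Z.
  by rewrite -[X in X * _]expr1 coefs_qM subn1 coefE //; apply: colours2_periodic.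
have : coefs (1 / residue_prod colours1 - fps_q / residue_prod colours2) n.+1
    = coefs (1 / residue_prod colours3) n.+1 by rewrite residue_prod_identity.
rewrite !mul1r coefsB coef2.
rewrite (coefE _ _ (erefl _) colours1_periodic).
rewrite (coefE _ _ (erefl _) colours3_periodic) subn1 => /eqP.
by rewrite -subr_eq0 => /eqP.
Qed.
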